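(* Assume that $\mathbb{E} Z < \infty$ and that $q_1>0$. Then there exist a positive random variable $N$ with $\mathbb{P}\{N<\infty\}=1$ and a (random) index $I\in\{0,-1,-2,\ldots\}$ such that, with probability one, $C_n=I$ for all $n\ge N$.
   Context: $\mathbb{N}=\{1,2,\ldots\}$. Let $Z,Z_1,Z_2,\ldots$ be independent, identically distributed random variables taking values in $\mathbb{N}$, and write $q_n=\mathbb{P}\{Z=n\}$ for $n\in\mathbb{N}$. The random coloring $(C_n)_{n\in\mathbb{Z}}$ of the integers is defined by $C_i=i$ for all integers $i\le 0$, and recursively $C_n=C_{n-Z_n}$ for $n\in\mathbb{N}$. *)

(* Defs.v *)
From HB Require Import structures.
From mathcomp Require Import all_boot all_order all_algebra finmap.
From mathcomp Require Import all_classical all_reals all_analysis measurable_realfun.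

Set Implicit Arguments.
Unset Strict Implicit.
Unset Printing Implicit Defensive.

Import Order.TTheory GRing.Theory Num.Theory.

Local Open Scope classical_set_scope.
Local Open Scope ring_scope.

HB.instance Definition _ := isPointed.Build int 0.

(* As for [nat], every subset of [int] is measurable. *)
HB.instance Definition _ := @isMeasurable.Build default_measure_display
  int discrete_measurable discrete_measurable0
  discrete_measurableC discrete_measurableU.

Definition mutually_independent (d d' : measure_display)
    (T : measurableType d) (T' : measurableType d') (R : realType)
    (P : probability T R) (I : choiceType) (X : I -> {RV P >-> T'}) : Prop :=
  forall (J : {fset I}) (A : I -> set T'),
    (forall i, i \in J -> measurable (A i)) ->
    P (\bigcap_(i in [set` J]) (X i @^-1` A i))
    = (\prod_(i <- J) P (X i @^-1` A i))%E.

Definition identically_distributed (d d' : measure_display)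
    (T : measurableType d) (T' : measurableType d') (R : realType)
    (P : probability T R) (I : choiceType) (X : I -> {RV P >-> T'}) : Prop :=
  forall (i j : I) (A : set T'),
    measurable A -> distribution P (X i) A = distribution P (X j) A.

(* [z n] is the jump made from the integer [n >= 1]; [z 0] is not used. *)
Definition coloring (z : nat -> nat) (c : int -> int) : Prop :=
  (forall i : int, i <= 0 -> c i = i) /\
  (forall n : nat, (0 < n)%N -> c n%:Z = c (n%:Z - (z n)%:Z)).

Lemma coloring_exists_unique (z : nat -> nat) :
  (forall n, (0 < z n)%N) -> exists! c, coloring z c.
Proof.
move=> z_gt0.
pose p (i : int) : int := if i is Posz n.+1 then n.+1%:Z - (z n.+1)%:Z else i.
have p_le n m : (n <= m)%N -> p n.+1%:Z <= m%:Z.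
  move=> nm; rewrite /p lerBlDr -PoszD lez_nat.
  by rewrite -addn1 leq_add // z_gt0.
have p_id (i : int) : i <= 0 -> p i = i by case: i => [[]|].
have stab k : forall m (i : int), i <= k%:Z -> (k <= m)%N ->
    iter m p i = iter k p i.
  elim: k => [|k IH] m i ik km.
    by elim: m {km} => //= m ->; rewrite p_id.
  case: m km => // m km; rewrite !iterSr; apply: IH => //.
  case: i ik => [[|n]|n] // ik; exact: p_le.
exists (fun i : int => iter `|i|%N p i); split.
  split=> [i i0|[//|n] _].
    by elim: `|i|%N => //= m ->; rewrite p_id.
  rewrite -[n.+1%:Z - _]/(p n.+1%:Z) [LHS]iterSr.
  have := p_le n n (leqnn n); move: (p n.+1%:Z) => [m|m] mn.
    exact: stab.
  by rewrite (stab 0%N n) // (stab 0%N).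
move=> c [c0 cS]; apply/funext => i.
have key k : forall i : int, i <= k%:Z -> iter k p i = c i.
  elim: k => [|k IH] {}i ik; first by rewrite c0.
  rewrite iterSr; case: i ik => [[|n]|n] // ik.
  - by rewrite IH.
  - by rewrite cS // IH //; exact: p_le.
  - by rewrite IH.
by apply: key; case: i.
Qed.

(* Main.v *)
From HB Require Import structures.
Require Import Defs.
From mathcomp Require Import all_boot all_order all_algebra finmap.
From mathcomp Require Import all_classical all_reals all_analysis measurable_realfun.
From mathcomp Require Import zify lra.

(** Call [n >= 0] a cut when no site after [n] jumps below [n], that is
    [Z_(n+k+1) <= k+1] for all [k >= 0].  Every site after a cut [n] reaches [n]
    by successive jumps, so the coloring is constant from [n] on
    ([coloring_constant_after_cut]).  Hence it is enough to show that almost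
    surely a cut exists ([some_cut_almost_surely]).  A cut can then be chosen
    measurably ([measurable_index]); [I] is its color, and [N] exceeds it by
    one, which makes [N] positive even when the cut is [0].

    Put [a_k = P (Z > k+1)].  A given [n] is a cut with probability
    [prod_k (1 - a_k)].  This is positive because [sum_k a_k <= E Z] is finite
    ([sum_tail_le_expectation]) and each factor is at least [q_1 > 0]
    ([prod_one_sub_bounded_below]).  The cut events at different sites are not
    independent, but they are nearly so at sites far apart.  For a length [K]
    consider the sites [jK], [j < M], and require the condition for a cut at
    [jK] only for [k < K].  These truncated events depend on disjoint blocks of
    variables, so none of them happens with probability at most [(1 - p)^M],
    where [p] bounds the partial products from below ([no_block_occurs]).  The
    conditions dropped at one site are all met except with probability at most
    [sum_(k >= K) a_k].  Therefore
      [P (no cut) <= (1 - p)^M + M * sum_(k >= K) a_k],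
    which is made small by choosing first [M] and then [K]. *)

Import Order.TTheory GRing.Theory Num.Theory.

Local Open Scope classical_set_scope.
Local Open Scope ring_scope.

(** * Independent blocks of events *)

(** Inclusion-exclusion on the last block: the event that blocks [0..M-1] do not
    occur minus the part of it where block [M] occurs.  That part has the same
    shape with the intersection over [s] enlarged by block [M], which is why the
    induction needs the extra intersection. *)
Lemma no_block_occurs_given (d : measure_display) (T : measurableType d)
    (R : realType) (P : probability T R) (I : choiceType) (G : I -> set T)
    (mG : forall i, measurable (G i))
    (indep : forall s : seq I, uniq s ->
      P (\bigcap_(i in [set` s]) G i) = (\prod_(i <- s) fine (P (G i)))%:E)
    (b : nat -> seq I) (b_uniq : forall j, uniq (b j))
    (b_disj : forall j k, (j < k)%N -> ~~ has (mem (b j)) (b k))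
    (M : nat) (s : seq I) (s_uniq : uniq s)
    (s_disj : forall j, (j < M)%N -> ~~ has (mem (b j)) s) :
  P (\bigcap_(i in [set` s]) G i `&`
       \bigcap_(j in `I_M) ~` \bigcap_(i in [set` b j]) G i)
  = ((\prod_(i <- s) fine (P (G i))) *
       \prod_(j < M) (1 - \prod_(i <- b j) fine (P (G i))))%:E.
Proof.
have mE (r : seq I) : measurable (\bigcap_(i in [set` r]) G i).
  by apply: fin_bigcap_measurable => // i _; exact: mG.
have mD n : measurable (\bigcap_(j in `I_n) ~` \bigcap_(i in [set` b j]) G i).
  by apply: fin_bigcap_measurable => // j _; exact: measurableC.
elim: M s s_uniq s_disj => [|M IH] s s_uniq s_disj.
  rewrite II0 bigcap_set0 setIT big_ord0 mulr1; exact: indep.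
rewrite IIS bigcap_setU bigcap_set1 setIA -setDE.
have sM_disj j : (j < M)%N -> ~~ has (mem (b j)) s.
  by move=> jM; apply: s_disj; exact: ltnW.
set S := \bigcap_(i in [set` s]) G i.
set D := \bigcap_(j in _) _.
set B := \bigcap_(i in _) _.
have -> : P ((S `&` D) `\` B) = (P (S `&` D) - P ((S `&` D) `&` B))%E.
  have mSD : measurable (S `&` D) by exact: measurableI (mE s) (mD M).
  apply: measureD; [exact: mSD|exact: mE|].
  by rewrite ltey_eq fin_num_measure.
have -> : S `&` D `&` B = \bigcap_(i in [set` s ++ b M]) G i `&` D.
  rewrite setIAC; congr (_ `&` _); rewrite -bigcap_setU; congr bigcap.
  by apply/seteqP; split => i /=; rewrite mem_cat => /orP.
rewrite IH //.
rewrite IH; last 2 first.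
- by rewrite cat_uniq s_uniq b_uniq has_sym s_disj.
- by move=> j jM; rewrite has_cat negb_or sM_disj // b_disj.
rewrite big_cat big_ord_recr /= -EFinB; congr EFin.
by rewrite mulrA mulrBr mulr1 mulrAC.
Qed.

Lemma no_block_occurs (d : measure_display) (T : measurableType d)
    (R : realType) (P : probability T R) (I : choiceType) (G : I -> set T)
    (mG : forall i, measurable (G i))
    (indep : forall s : seq I, uniq s ->
      P (\bigcap_(i in [set` s]) G i) = (\prod_(i <- s) fine (P (G i)))%:E)
    (b : nat -> seq I) (b_uniq : forall j, uniq (b j))
    (b_disj : forall j k, (j < k)%N -> ~~ has (mem (b j)) (b k))
    (M : nat) :
  P (\bigcap_(j in `I_M) ~` \bigcap_(i in [set` b j]) G i)
  = (\prod_(j < M) (1 - \prod_(i <- b j) fine (P (G i))))%:E.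
Proof.
have := @no_block_occurs_given _ _ _ _ _ _ mG indep _ b_uniq b_disj M [::].
by rewrite set_nil bigcap_set0 setTI big_nil mul1r; apply.
Qed.

(** The product over a finite set enumerates it in an arbitrary order; a
    sequence keeps an interval in its natural order, ready for reindexing. *)
Lemma mutually_independent_preimages (d d' : measure_display)
    (T : measurableType d) (T' : measurableType d') (R : realType)
    (P : probability T R) (I : choiceType) (X : I -> {RV P >-> T'})
    (A : I -> set T') (mA : forall i, measurable (A i)) (s : seq I) :
  mutually_independent X -> uniq s ->
  P (\bigcap_(i in [set` s]) (X i @^-1` A i))
  = (\prod_(i <- s) fine (P (X i @^-1` A i)))%:E.
Proof.
move=> indep s_uniq; have := indep [fset i in s]%fset A (fun i _ => mA i).
have -> : [set` [fset i in s]%fset] = [set` s].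
  by apply/seteqP; split=> i /=; rewrite inE.
move=> ->; rewrite -prodEFin.
have -> : (\prod_(i <- [fset i in s]%fset) P (X i @^-1` A i) =
   \prod_(i <- s) P (X i @^-1` A i))%E.
  apply: perm_big; apply: uniq_perm => // i; by rewrite inE.
by apply: eq_bigr => i _; rewrite fineK // fin_num_measure // -[_ @^-1` _]setTI;
  apply: measurable_funP.
Qed.

(** * Infinite products of factors close to one *)

(** The Weierstrass product inequality. *)
Lemma prod_one_sub_ge (R : realFieldType) (a : nat -> R) (m n : nat) :
  (forall k, 0 <= a k <= 1) -> (m <= n)%N ->
  1 - \sum_(m <= k < n) a k <= \prod_(m <= k < n) (1 - a k).
Proof.
move=> a01; elim: n => [|n IH].
  by rewrite leqn0 => /eqP->; rewrite !big_geq // subr0.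
rewrite leq_eqVlt => /predU1P[->|mn]; first by rewrite !big_geq // subr0.
rewrite !big_nat_recr //=; have {IH} := IH mn.
have : 0 <= \sum_(m <= k < n) a k by apply: sumr_ge0 => k _; case/andP: (a01 k).
move: (\sum_(_ <= _ < _) _) (\prod_(_ <= _ < _) _) => S Q S0 SQ.
have /andP[an0 an1] := a01 n.
nra.
Qed.

Lemma summable_tail_small (R : realType) (f : nat -> \bar R) (e : R) :
  (forall k, (0 <= f k)%E) -> (\sum_(0 <= k <oo) f k < +oo)%E -> 0 < e ->
  exists m, (\sum_(m <= k <oo) f k <= e%:E)%E.
Proof.
move=> f0 f_fin e0.
have /fine_cvgP[tail_fin tail0] :
    (\sum_(n <= k <oo) f k @[n --> \oo] --> 0%E)%E.
  by apply: nneseries_tail_cvg => // k _; exact: f0.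
near \oo => m; exists m.
rewrite -[leLHS]fineK; last by near: m.
by rewrite lee_fin; near: m; exact: (cvgr_le _ tail0).
Unshelve. all: by end_near. Qed.

(** After an index [m] where the remaining sum is at most 1/2, the factors
    multiply to at least 1/2; the first [m] factors are each at least [q]. *)
Lemma prod_one_sub_bounded_below (R : realType) (q : R) (a : nat -> R) :
  0 < q -> (forall k, 0 <= a k <= 1 - q) ->
  (\sum_(0 <= k <oo) (a k)%:E < +oo)%E ->
  exists2 p : R, 0 < p <= 1 & forall n, p <= \prod_(k < n) (1 - a k).
Proof.
move=> q0 aq a_fin.
have a0 k : 0 <= a k by case/andP: (aq k).
have a1 k : a k <= 1 by case/andP: (aq k) => _; lra.
have q1 : q <= 1 by case/andP: (aq 0%N); lra.
have [m tail] : exists m, forall n, \sum_(m <= k < n) a k <= 1 / 2.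
  have af0 k : (0 <= (a k)%:E)%E by rewrite lee_fin.
  have half_gt0 : 0 < 1 / 2 :> R by lra.
  have [m tail] := summable_tail_small _ _ _ af0 a_fin half_gt0.
  exists m => n; rewrite -lee_fin -sumEFin; apply: le_trans tail.
  by apply: nneseries_lim_ge => k _ _; rewrite lee_fin.
exists (q ^+ m / 2).
  by rewrite divr_gt0 ?exprn_gt0 //=; have := exprn_ile1 m (ltW q0) q1; lra.
move=> n; apply: (@le_trans _ _ (\prod_(k < m + n) (1 - a k))).
  rewrite -(big_mkord xpredT (fun k => 1 - a k)) (big_cat_nat (n := m)) //=;
    last exact: leq_addr.
  apply: ler_pM.
  - by rewrite exprn_ge0 // ltW.
  - by rewrite invr_ge0.
  - rewrite big_mkord -[m in leLHS]card_ord -prodr_const; apply: ler_prod => k _.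
    by rewrite ltW //=; case/andP: (aq k); lra.
  - apply: le_trans (@prod_one_sub_ge _ a m (m + n) _ _); rewrite ?leq_addr //.
      by have := tail (m + n)%N; lra.
    by move=> k; rewrite a0 a1.
rewrite addnC -(big_mkord xpredT (fun k => 1 - a k)) (big_cat_nat (n := n)) //=;
  last exact: leq_addr.
rewrite big_mkord.
rewrite ler_piMr //; first by apply: prodr_ge0 => k _; rewrite subr_ge0.
by apply: prodr_ile1 => k _; rewrite subr_ge0 a1 gerBl a0.
Qed.

(** * Cuts of a coloring *)

Definition cut (z : nat -> nat) (n : nat) : Prop :=
  forall k, (z (n + k).+1 <= k.+1)%N.

Lemma coloring_constant_after_cut (z : nat -> nat) (c : int -> int) (n : nat) :
  (forall m, (0 < z m)%N) -> coloring z c -> cut z n ->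
  forall m, (n <= m)%N -> c m%:Z = c n%:Z.
Proof.
move=> z_gt0 [_ cS] n_cut m /subnKC<-; move: (m - n)%N => {m} k.
elim/ltn_ind: k => -[|k] IH; first by rewrite addn0.
have z1 := z_gt0 (n + k).+1; have zk := n_cut k.
rewrite addnS cS // -(IH (k.+1 - z (n + k).+1)%N); last by lia.
by congr c; lia.
Qed.

Lemma coloring_le0 (z : nat -> nat) (c : int -> int) (i : int) :
  (forall m, (0 < z m)%N) -> coloring z c -> c i <= 0.
Proof.
move=> z_gt0 [c0 cS].
have le0 m : forall j : int, j <= m%:Z -> c j <= 0.
  elim: m => [|m IH] j jm; first by rewrite c0.
  have [jm'|mj] := leP j m%:Z; first exact: IH.
  have -> : j = m.+1%:Z by lia.
  by rewrite cS //; apply: IH; have := z_gt0 m.+1; lia.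
by apply: (le0 `|i|%N); lia.
Qed.

(** * Measurability *)

Lemma measurable_preimage (d d' : measure_display) (T : measurableType d)
    (T' : measurableType d') (f : T -> T') (A : set T') :
  measurable_fun setT f -> measurable A -> measurable (f @^-1` A).
Proof. by move=> mf mA; rewrite -[_ @^-1` _]setTI; exact: mf. Qed.

Lemma measurable_fun_countable (d d' : measure_display) (T : measurableType d)
    (T' : measurableType d') (f : T -> T') :
  countable [set: T'] -> (forall v, measurable (f @^-1` [set v])) ->
  measurable_fun setT f.
Proof.
move=> countT' mf _ A _; rewrite setTI.
have -> : f @^-1` A = \bigcup_v (f @^-1` ([set v] `&` A)).
  apply/seteqP; split => [w Aw|w [v _] [] //]; by exists (f w).
apply: countable_bigcupT_measurable => // v.
have [vA|vA] := pselect (A v).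
  by rewrite (_ : _ `&` A = [set v]) //; apply/setIidPl => _ ->.
rewrite (_ : _ `&` A = set0) ?preimage_set0 //.
by apply/seteqP; split=> [u [->]|].
Qed.

(** The color of [m+1] is the color of [m - k] on the event [Z_(m+1) = k+1], and
    [m - k <= m]: induction on an upper bound of the site. *)
Lemma measurable_coloring (d : measure_display) (T : measurableType d)
    (Z : nat -> T -> nat) (C : int -> T -> int) :
  (forall n w, (0 < Z n w)%N) -> (forall n, measurable_fun setT (Z n)) ->
  (forall w, coloring (fun n => Z n w) (fun i => C i w)) ->
  forall i, measurable_fun setT (C i).
Proof.
move=> Z_gt0 mZ C_col i.
apply: measurable_fun_countable => [|v]; first exact: countableP.
suff mC m : forall j : int, j <= m%:Z -> measurable (C j @^-1` [set v]).
  by apply: (mC `|i|%N); lia.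
elim: m => [|m IH] j jm.
  have -> : C j = cst j by apply/funext => w; rewrite (C_col w).1.
  exact: measurable_preimage.
have [jm'|mj] := leP j m%:Z; first exact: IH.
have -> : j = m.+1%:Z by lia.
have -> : C m.+1%:Z @^-1` [set v] =
    \bigcup_k (Z m.+1 @^-1` [set k.+1] `&` C (m%:Z - k%:Z) @^-1` [set v]).
  have CS w : C m.+1%:Z w = C (m%:Z - (Z m.+1 w).-1%:Z) w.
    by rewrite (C_col w).2 //; congr C; have := Z_gt0 m.+1 w; lia.
  apply/seteqP; split => [w /=|w [k _] [/= Zk Cv]]; last by rewrite CS Zk.
  by rewrite CS => Cv; exists (Z m.+1 w).-1 => //; split => //=; rewrite prednK.
apply: bigcup_measurable => k _; apply: measurableI.
  exact: measurable_preimage.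
by apply: IH; lia.
Qed.

Lemma measurable_cut (d : measure_display) (T : measurableType d)
    (Z : nat -> T -> nat) (n : nat) :
  (forall i, measurable_fun setT (Z i)) ->
  measurable [set w | cut (fun m => Z m w) n].
Proof.
move=> mZ.
have -> : [set w | cut (fun m => Z m w) n] =
    \bigcap_k Z (n + k).+1 @^-1` [set m | m <= k.+1]%N.
  by apply/seteqP; split => [w n_cut k _|w n_cut k]; exact: n_cut.
by apply: bigcap_measurableType => k _; exact: measurable_preimage.
Qed.

(** Choosing the least index makes the choice measurable.  The value [n.+1]
    stands for the index [n], so that [0] can mean that there is none. *)
Lemma measurable_index (d : measure_display) (T : measurableType d)
    (A : nat -> set T) : (forall n, measurable (A n)) ->
  exists t : T -> nat, [/\ measurable_fun setT t,
    (forall w n, t w = n.+1 -> A n w) &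
    (forall w, t w = 0%N -> ~ (\bigcup_n A n) w)].
Proof.
move=> mA.
pose a w n := `[< A n w >].
pose t w :=
  if pselect (exists n, a w n) is left ex then (ex_minn ex).+1 else 0%N.
have tS w n : t w = n.+1 <-> A n w /\ forall m, (m < n)%N -> ~ A m w.
  rewrite /t; case: pselect => [ex|no]; last first.
    by split=> // -[An _]; case: no; exists n; apply/asboolP.
  case: ex_minnP => m /asboolP Am m_min; split=> [[<-]|[An n_min]].
    split=> // k km /asboolP/m_min; lia.
  have mn : (m <= n)%N by apply: m_min; exact/asboolP.
  have nm : (n <= m)%N by rewrite leqNgt; apply/negP => /n_min.
  by lia.
have t0 w : t w = 0%N -> ~ (\bigcup_n A n) w.
  rewrite /t; case: pselect => // no _ [n _ An]; apply: no.
  by exists n; apply/asboolP.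
exists t; split=> // [|w n /tS[]//].
apply: measurable_fun_countable => [|[|n]]; first exact: countableP.
  have -> : t @^-1` [set 0%N] = ~` \bigcup_n A n.
    apply/seteqP; split => [w /t0 //|w /= no].
    case tw: (t w) => [//|n]; case: no; exists n => //; by case: ((tS w n).1 tw).
  by apply: measurableC; exact: bigcup_measurable.
have -> : t @^-1` [set n.+1] = A n `&` \bigcap_(m in `I_n) ~` A m.
  by apply/seteqP; split => w /= /tS.
apply: measurableI => //; apply: fin_bigcap_measurable => // m _.
exact: measurableC.
Qed.

Lemma random_variable_of_measurable (d d' : measure_display)
    (T : measurableType d) (T' : measurableType d') (R : realType)
    (P : probability T R) (f : T -> T') :
  measurable_fun setT f -> exists X : {RV P >-> T'}, X =1 f.
Proof.
move=> mf.
pose X : {RV P >-> T'} := HB.pack f (isMeasurableFun.Build _ _ _ _ f mf).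
by exists X.
Qed.

(** * Almost sure existence of a cut *)

(** Exchange sum and integral: pointwise, the indicators of [k < X] add up to
    [X]. *)
Lemma sum_tail_le_expectation (d : measure_display) (T : measurableType d)
    (R : realType) (P : probability T R) (X : {RV P >-> nat}) :
  (\sum_(0 <= k <oo) P (X @^-1` [set m | k < m]%N)
     <= 'E_P[(fun w => (X w)%:R)])%E.
Proof.
have mX k : measurable (X @^-1` [set m | k < m]%N).
  by apply: measurable_preimage => //; exact: measurable_funP.
pose f k w : \bar R := (\1_(X @^-1` [set m | k < m]%N) w)%:E.
have f0 k w : (0 <= f k w)%E by rewrite lee_fin.
have mf k : measurable_fun setT (f k) by exact/measurable_EFinP.
have Pf k : P (X @^-1` [set m | k < m]%N) = (\int[P]_w f k w)%E.
  by rewrite integral_indic // setIT.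
rewrite (eq_eseriesr (fun k _ => Pf k)) -integral_nneseries // expectation.unlock.
apply: ge0_le_integral => //.
- by move=> w _; apply: nneseries_ge0.
- exact: ge0_emeasurable_sum.
- apply/measurable_EFinP => _ A _; rewrite setTI.
  apply: (measurable_preimage _ _ _ _ X [set m | A m%:R]) => //.
move=> w _; apply: lime_le; first exact: is_cvg_nneseries.
near=> n; rewrite sumEFin lee_fin.
have fE k : \1_(X @^-1` [set m | k < m]%N) w = (k < X w)%N%:R :> R.
  by rewrite indicE; congr (_%:R); congr nat_of_bool; apply/idP/idP; rewrite inE.
rewrite (eq_bigr _ (fun k _ => fE k)) -natr_sum ler_nat.
have : (\sum_(0 <= k < n) (k < X w)%N = minn n (X w))%N.
  elim: (n) => [|m IH]; first by rewrite big_geq // min0n.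
  by rewrite big_nat_recr //= IH; case: ltnP; lia.
by move=> ->; exact: geq_minr.
Unshelve. all: by end_near. Qed.

Lemma some_cut_almost_surely (d : measure_display) (T : measurableType d)
    (R : realType) (P : probability T R) (Z : nat -> {RV P >-> nat}) :
  mutually_independent Z -> identically_distributed Z ->
  ('E_P[(fun w => (Z 0%N w)%:R)] < +oo)%E ->
  (0 < P [set w | Z 0%N w = 1%N])%E ->
  P (~` \bigcup_n [set w | cut (fun m => Z m w) n]) = 0%E.
Proof.
move=> Z_indep Z_id EZ_fin q1_gt0.
have mZ i A : measurable (Z i @^-1` A).
  by apply: measurable_preimage => //; exact: measurable_funP.
have PZ i A : P (Z i @^-1` A) = P (Z 0%N @^-1` A) by exact: Z_id.
(* For every [n], this is the probability that [n+k+1] jumps below [n]. *)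
pose a k := fine (P (Z 0%N @^-1` [set m | k.+1 < m]%N)).
have aE i k : P (Z i @^-1` [set m | k.+1 < m]%N) = (a k)%:E.
  by rewrite PZ fineK // fin_num_measure.
have subaE i k : fine (P (Z i @^-1` [set m | m <= k.+1]%N)) = 1 - a k.
  have -> : Z i @^-1` [set m | m <= k.+1]%N = ~` (Z i @^-1` [set m | k.+1 < m]%N).
    apply/seteqP; split=> w /=; first by rewrite leqNgt => /negP.
    by move=> /negP; rewrite -leqNgt.
  by rewrite probability_setC // aE.
pose q := fine (P [set w | Z 0%N w = 1%N]).
have mq : measurable [set w | Z 0%N w = 1%N] by exact: mZ 0%N [set 1%N].
have q_gt0 : 0 < q by rewrite fine_gt0 // q1_gt0 ltey_eq fin_num_measure.
have a_ge0 k : 0 <= a k by rewrite fine_ge0.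
have a01 k : 0 <= a k <= 1 - q.
  have : q <= 1 - a k.
    rewrite -(subaE 0%N) fine_le ?fin_num_measure // le_measure ?inE //.
    by move=> w /= ->.
  by rewrite a_ge0 /=; lra.
have a_fin : (\sum_(0 <= k <oo) (a k)%:E < +oo)%E.
  apply: le_lt_trans EZ_fin; apply: le_trans (sum_tail_le_expectation _ _ _ _ _).
  apply: lee_nneseries => [k _ _|k _]; first by rewrite lee_fin.
  rewrite -(aE 0%N) le_measure ?inE // => w /=; exact: ltnW.
have [p /andP[p_gt0 p_le1] p_le] := prod_one_sub_bounded_below _ _ _ q_gt0 a01 a_fin.
apply/eqP; rewrite eq_le measure_ge0 andbT.
suff small (e : R) : 0 < e ->
    (P (~` \bigcup_n [set w | cut (fun m => Z m w) n]) <= e%:E)%E.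
  by apply/lee_addgt0Pr => e e_gt0; rewrite add0e; exact: small.
move=> e_gt0.
have e2 : 0 < e / 2 by lra.
have [M pM] : exists M, (1 - p) ^+ M <= e / 2.
  have : (1 - p) ^+ n @[n --> \oo] --> 0.
    by apply: cvg_expr; rewrite ger0_norm; lra.
  move=> /cvgr_le/(_ _ e2) [M _ MP]; exists M; exact: MP (leqnn M).
have af_ge0 k : (0 <= (a k)%:E)%E by rewrite lee_fin.
have eM_gt0 : 0 < e / 2 / M.+1%:R by rewrite divr_gt0.
have [K tailK] := summable_tail_small _ _ _ af_ge0 a_fin eM_gt0.
(* Block [j] tests for a cut at [jK].  A site [i = jK+k+1] of this block has
   [k = (i-1) mod K], so the event that [i] has to satisfy depends on [i] alone
   and not on the block. *)
pose G i := Z i @^-1` [set m | m <= (i.-1 %% K).+1]%N.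
pose b j := index_iota (j * K).+1 (j.+1 * K).+1.
pose D := \bigcap_(j in `I_M) ~` \bigcap_(i in [set` b j]) G i.
pose U := \bigcup_n [set w | cut (fun m => Z m w) n].
(* The condition for a cut at [jK] is violated outside its block. *)
pose F j := \bigcup_(k in ~` `I_K) Z (j * K + k).+1 @^-1` [set m | k.+1 < m]%N.
have mG i : measurable (G i) by exact: mZ.
have mD : measurable D.
  apply: fin_bigcap_measurable => // j _; apply: measurableC.
  by apply: fin_bigcap_measurable.
have mF j : measurable (F j) by exact: bigcup_measurable.
have mU : measurable U.
  apply: bigcup_measurable => n _; apply: measurable_cut => i.
  exact: measurable_funP.
have cover : ~` U `<=` D `|` \big[setU/set0]_(j < M) F j.
  move=> w no_cut; have [Dw|nD] := pselect (D w); [by left|right].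
  have [j [jM Bj]] : exists j, (j < M)%N /\ (\bigcap_(i in [set` b j]) G i) w.
    apply: contrapT => no_j; apply: nD => j jM Bj; apply: no_j; by exists j.
  rewrite -bigcup_mkord; exists j => //.
  have [k Zk] : exists k, (k.+1 < Z (j * K + k).+1 w)%N.
    apply: contrapT => no_k; apply: no_cut; exists (j * K)%N => // k.
    by rewrite leqNgt; apply/negP => Zk; apply: no_k; exists k.
  exists k => //= kK.
  have kb : (j * K + k).+1 \in b j.
    by rewrite mem_index_iota !ltnS leq_addr mulSn [(K + _)%N]addnC ltn_add2l.
  by have := Bj _ kb; rewrite /G /= modnMDl modn_small // leqNgt Zk.
have PD : (P D <= (e / 2)%:E)%E.
  rewrite no_block_occurs //; first last.
  - move=> j k jk; apply/hasPn => i; rewrite mem_index_iota => /andP[ki _].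
    rewrite inE mem_index_iota negb_and -!leqNgt; apply/orP; right.
    by apply: leq_trans ki; rewrite ltnS leq_mul2r jk orbT.
  - by move=> j; exact: iota_uniq.
  - move=> s s_uniq; exact: (mutually_independent_preimages _ _ _ _ _ _ _
       Z (fun i => [set m | m <= (i.-1 %% K).+1]%N)).
  rewrite lee_fin; apply: le_trans pM.
  rewrite -[M in leRHS]card_ord -prodr_const; apply: ler_prod => j _.
  have -> : \prod_(i <- b j) fine (P (G i)) = \prod_(k < K) (1 - a k).
    rewrite /b big_add1 /= -{1}[(j * K)%N]add0n big_addn mulSn addnK big_mkord.
    by apply: eq_bigr => k _; rewrite subaE addnC modnMDl modn_small.
  have := p_le K; set x := \prod_(_ < _) _.
  have : x <= 1.
    by apply: prodr_ile1 => k _; have := a01 k; lra.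
  lra.
have PF j : (P (F j) <= (e / 2 / M.+1%:R)%:E)%E.
  apply: le_trans tailK; under eq_eseriesr => k _ do rewrite -(aE (j * K + k).+1).
  exact: measure_sigma_subadditive_tail.
have mFM : measurable (\big[setU/set0]_(j < M) F j) by exact: bigsetU_measurable.
have PFM : (P (\big[setU/set0]_(j < M) F j) <= (e / 2)%:E)%E.
  apply: (@le_trans _ _ (\sum_(j < M) P (F j))%E).
    exact: content_subadditive.
  apply: (@le_trans _ _ (\sum_(j < M) (e / 2 / M.+1%:R)%:E)%E).
    by apply: lee_sum => j _; exact: PF.
  rewrite sumEFin lee_fin sumr_const card_ord -[leLHS]mulr_natr mulrAC.
  by rewrite ler_pdivrMr // ler_wpM2l ?ltW // ltr_nat.
rewrite [e in leRHS]splitr EFinD.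
apply: le_trans (leeD PD PFM).
apply: le_trans (measureU2 _ mD mFM).
by apply: le_measure; rewrite ?inE //; [exact: measurableC|exact: measurableU].
Qed.

(** * Eventual constancy of the coloring *)

(* Z 0 is the generic variable Z; for n >= 1, Z n is Z_n. *)
Theorem theorem1 (d : measure_display) (T : measurableType d) (R : realType)
    (P : probability T R) (Z : nat -> {RV P >-> nat}) (C : int -> T -> int)
    (Z_gt0 : forall n w, (0 < Z n w)%N)
    (Z_indep : mutually_independent Z)
    (Z_id : identically_distributed Z)
    (C_col : forall w, coloring (fun n => Z n w) (fun i => C i w))
    (EZ_fin : ('E_P[(fun w => (Z 0%N w)%:R)] < +oo)%E)
    (q1_gt0 : (0 < P [set w | Z 0%N w = 1%N])%E) :
  exists (N : {RV P >-> \bar R}) (I : {RV P >-> int}),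
    [/\ (forall w, (0 < N w)%E),
        P [set w | (N w < +oo)%E] = 1%E,
        (forall w, I w <= 0) &
        {ae P, forall w, forall n : int, (N w <= n%:~R%:E)%E -> C n w = I w}].
Proof.
pose A n := [set w | cut (fun m => Z m w) n].
have mZ i : measurable_fun setT (Z i) by exact: measurable_funP.
have mA n : measurable (A n) by exact: measurable_cut.
have mC := measurable_coloring _ _ (fun n => Z n : T -> nat) _ Z_gt0 mZ C_col.
have [t [mt tS t0]] := measurable_index _ _ _ mA.
pose g m : \bar R := if m is 0%N then +oo%E else m%:R%:E.
have mN : measurable_fun setT (g \o t) by exact: measurableT_comp.
have mI : measurable_fun setT (fun w => C (t w).-1%:Z w).
  apply: measurable_fun_countable => [|v]; first exact: countableP.
  have -> : (fun w => C (t w).-1%:Z w) @^-1` [set v] =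
      \bigcup_n (t @^-1` [set n] `&` C n.-1%:Z @^-1` [set v]).
    apply/seteqP; split => [w Cv|w [n _] [/= <-] //]; by exists (t w).
  apply: bigcup_measurable => n _.
  by apply: measurableI; exact: measurable_preimage.
have [N NE] := random_variable_of_measurable _ _ _ _ _ P _ mN.
have [I IE] := random_variable_of_measurable _ _ _ _ _ P _ mI.
exists N, I; split.
- by move=> w; rewrite NE /= /g; case: (t w) => [|n]; rewrite ?lte_fin ?ltr0Sn.
- have mNfin : measurable [set w | (N w < +oo)%E].
    have -> : [set w | (N w < +oo)%E] = t @^-1` [set~ 0%N].
      apply/seteqP; split => w /=; rewrite NE /= /g; case: (t w) => //.
      by move=> n _; rewrite ltry.
    exact: measurable_preimage.
  have no0 := some_cut_almost_surely _ _ _ _ _ Z_indep Z_id EZ_fin q1_gt0.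
  apply/eqP; rewrite eq_le probability_le1 //=.
  have <- : P (\bigcup_n A n) = 1%E.
    have mU : measurable (\bigcup_n A n) by exact: bigcup_measurable.
    by rewrite -[X in P X]setCK probability_setC ?no0 ?sube0 //; exact: measurableC.
  apply: le_measure; rewrite ?inE //; first exact: bigcup_measurable.
  move=> w Aw /=; rewrite NE /= /g; case tw: (t w) => [|n]; last by rewrite ltry.
  by have := t0 _ tw.
- by move=> w; rewrite IE; exact: coloring_le0 (fun n => Z_gt0 n w) (C_col w).
(* With the value [+oo] of [N] in the absence of a cut, the conclusion holds at
   every sample point. *)
- apply: aeW => w n; rewrite NE IE /= /g.
  case tw: (t w) => [//|m]; rewrite lee_fin -[m.+1%:R]/(m.+1%:Z%:~R) ler_int => mn.
  have -> : n = `|n|%N%:Z by lia.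
  apply: coloring_constant_after_cut (C_col w) (tS _ _ tw) _ _ => //.
  lia.
Qed.
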